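(* Let $m\ge 1$ be an odd integer. Then the quaternary cyclic codes $\mathcal{C}_{(0,m)}$ and $\mathcal{C}_{(1,m)}$ of length $n=4^m-1$ form a pair of odd-like duadic codes over $\mathbb{F}_4$.
   Context: Let $m\ge 1$ be an integer and $n=4^m-1$. For an integer $0\le i\le 4^m-1$ with base-$4$ expansion $i=\sum_{j=0}^{m-1} i_j4^j$, $i_j\in\{0,1,2,3\}$, the $4$-weight is $w_4(i)=\sum_{j=0}^{m-1} i_j$ (sum in $\mathbb{Z}$). For $e\in\{0,1\}$ put $T_{(e,m)}=\{1\le i\le n-1 : w_4(i)\equiv e \pmod 2\}$. Fix a generator $\alpha$ of $\mathbb{F}_{4^m}^*$. The code $\mathcal{C}_{(e,m)}$ is the cyclic code of length $n$ over $\mathbb{F}_4$ (ideal of $\mathbb{F}_4[x]/(x^n-1)$) with generator polynomial $g_{(e,m)}(x)=\prod_{j\in T_{(e,m)}}(x-\alpha^j)\in\mathbb{F}_4[x]$, i.e. with defining set $T_{(e,m)}$ with respect to $\alpha$. Odd-like duadic codes: two cyclic codes of length $n$ over $\mathbb{F}_q$ with $\gcd(n,q)=1$, with defining sets $T_1,T_2$ (with respect to the same primitive $n$-th root of unity), $0\notin T_1$, $0\notin T_2$, form a pair of odd-like duadic codes if and only if (1) $T_1\cup T_2=\{1,2,\dots,n-1\}$ and $T_1\cap T_2=\emptyset$, and (2) there is an integer $b$ coprime to $n$ such that multiplication by $b$ modulo $n$ (the multiplier $\mu_b$) maps $T_1$ onto $T_2$ and $T_2$ onto $T_1$. *)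

(* Defs.v *)
From HB Require Import structures.
From mathcomp Require Import all_boot all_order all_algebra.
From mathcomp Require Import all_fingroup all_solvable all_field zify.

Set Implicit Arguments.
Unset Strict Implicit.
Unset Printing Implicit Defensive.

Import GRing.Theory.
Local Open Scope ring_scope.

(* Residues modulo n, and in particular defining sets, live in 'I_n. *)
Definition multiplier (n b : nat) (i : 'I_n) : 'I_n :=
  Ordinal (ltn_pmod (b * i) (leq_ltn_trans (leq0n i) (ltn_ord i))).

Section CyclicCodes.

Variables (F : finFieldType) (n : nat).

(* {poly %/ h} is the quotient by (h) only when h is monic and nonconstant,
   i.e. here when 0 < n. *)
Definition cyclic_ring := {poly %/ ('X^n - 1 : {poly F})}.

Definition cyclic_code (C : {set cyclic_ring}) : Prop :=
  0 \in C /\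
  (forall a x y : cyclic_ring, x \in C -> y \in C -> a * x + y \in C).

Definition ideal_gen (g : {poly F}) : {set cyclic_ring} :=
  [set a * in_qpoly ('X^n - 1) g | a in [set: cyclic_ring]].

Definition generator_poly (C : {set cyclic_ring}) (g : {poly F}) : Prop :=
  [/\ g \is monic, g %| 'X^n - 1 & C = ideal_gen g].

Variables (L : fieldType) (iota : {rmorphism F -> L}) (beta : L).

Definition zeros_poly (T : {set 'I_n}) : {poly L} :=
  \prod_(j in T) ('X - (beta ^+ j)%:P).

Definition defining_set (C : {set cyclic_ring}) (T : {set 'I_n}) : Prop :=
  exists2 g, generator_poly C g & map_poly iota g = zeros_poly T.

Definition odd_like_duadic_pair (C1 C2 : {set cyclic_ring}) : Prop :=
  [/\ coprime n #|F|, n.-primitive_root beta, cyclic_code C1, cyclic_code C2 &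
   exists T1 T2 : {set 'I_n},
   [/\ defining_set C1 T1 /\ defining_set C2 T2,
       (forall i, i \in T1 -> i != 0%N :> nat) /\
       (forall i, i \in T2 -> i != 0%N :> nat),
       T1 :|: T2 = [set i : 'I_n | (0 < i)%N] /\ T1 :&: T2 = set0 &
       exists b : nat, [/\ coprime b n,
         [set multiplier b i | i in T1] = T2 &
         [set multiplier b i | i in T2] = T1]]].

End CyclicCodes.

Definition weight4 (m i : nat) : nat := (\sum_(j < m) (i %/ 4 ^ j) %% 4)%N.

Definition Tset (e m : nat) : {set 'I_(4 ^ m - 1)} :=
  [set i : 'I_(4 ^ m - 1) | (0 < i)%N && (weight4 m i == e %[mod 2])].

Section QuaternaryCodes.

Variables (F : finFieldType) (L : fieldType) (iota : {rmorphism F -> L}).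

(* Preimage under iota, with value 0 off its image. *)
Definition descend (y : L) : F := odflt 0 [pick x | iota x == y].

(* The product of the x - alpha^j has its coefficients in L; this is the
   corresponding polynomial over F, see Cgen_polyE below. *)
Definition Cgen_poly (e m : nat) (alpha : L) : {poly F} :=
  map_poly descend (zeros_poly alpha (Tset e m)).

Definition Ccode (e m : nat) (alpha : L) : {set cyclic_ring F (4 ^ m - 1)} :=
  ideal_gen (4 ^ m - 1) (Cgen_poly e m alpha).

End QuaternaryCodes.

Lemma weight4_recl m i : weight4 m.+1 i = (i %% 4 + weight4 m (i %/ 4))%N.
Proof.
rewrite /weight4 big_ord_recl expn0 divn1; congr (_ + _)%N.
by apply: eq_bigr => j _; rewrite /= /bump /= add1n expnS divnMA.
Qed.

Lemma weight4_recr m d r : (r < 4 ^ m)%N -> (d < 4)%N ->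
  weight4 m.+1 (d * 4 ^ m + r) = (weight4 m r + d)%N.
Proof.
move=> lr ld; rewrite /weight4 big_ord_recr /=.
rewrite divnMDl ?expn_gt0 // (divn_small lr) addn0 (modn_small ld).
congr (_ + _)%N; apply: eq_bigr => -[j lj] _ /=.
have -> : (d * 4 ^ m = d * 4 ^ (m - j).-1 * 4 * 4 ^ j)%N.
  by rewrite -!mulnA -expnS -expnD; congr (_ * 4 ^ _)%N; lia.
by rewrite divnMDl ?expn_gt0 // modnMDl.
Qed.

Lemma weight4_shift m i : (i < 4 ^ m - 1)%N ->
  weight4 m (4 * i %% (4 ^ m - 1)) = weight4 m i.
Proof.
case: m => [|m] // li.
have q0 : (0 < 4 ^ m)%N by rewrite expn_gt0.
have e4 : (4 ^ m.+1 = 4 * 4 ^ m)%N by rewrite expnS.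
have lr := ltn_pmod i q0; have ld : (i %/ 4 ^ m < 4)%N.
  by rewrite ltn_divLR //; lia.
set d := (i %/ 4 ^ m)%N in ld *; set r := (i %% 4 ^ m)%N in lr *.
have Ei : i = (d * 4 ^ m + r)%N by exact: divn_eq.
have -> : (4 * i %% (4 ^ m.+1 - 1) = r * 4 + d)%N.
  have -> : (4 * i = d * (4 ^ m.+1 - 1) + (r * 4 + d))%N.
    by rewrite Ei e4; nia.
  rewrite modnMDl modn_small // e4.
  have [/eqP Er|] := boolP (r == (4 ^ m - 1)%N); last by move/eqP; lia.
  have : d != 3 by apply/eqP => Ed; move: li; rewrite Ei Ed Er; lia.
  by move/eqP; lia.
rewrite weight4_recl modnMDl divnMDl // (modn_small ld) (divn_small ld) addn0.
by rewrite [in RHS]Ei weight4_recr // addnC.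
Qed.

Lemma multiplier4_inj m : injective (@multiplier (4 ^ m - 1) 4).
Proof.
case: m => [[]//|m] i j /(congr1 val) /= /eqP.
have c4 : coprime (4 ^ m.+1 - 1) 4.
  by rewrite subn1 (coprimeXr 2 (_ : coprime _ 2)) // coprimen2 -subn1 oddB
     ?expn_gt0 // oddX.
rewrite -[(_ == _)]/(4 * i == 4 * j %[mod _])%N.
wlog lij : i j / (i <= j)%N.
  by move=> IH; case/orP: (leq_total i j) => [/IH//|/IH IH' /eqP/esym/eqP/IH'].
rewrite eq_sym eqn_mod_dvd ?leq_mul // -mulnBr Gauss_dvdr // => h.
apply/val_inj => /=; have lj := ltn_ord j.
have [//|ne] := eqVneq (val i) (val j).
by have /dvdn_leq := h; move/(_ ltac:(move/eqP: ne => /= ne; lia)); lia.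
Qed.

Lemma multiplier4_Tset e m (i : 'I_(4 ^ m - 1)) :
  (multiplier 4 i \in Tset e m) = (i \in Tset e m).
Proof.
rewrite !inE /= weight4_shift //; congr (_ && _).
have n0 : (0 < 4 ^ m - 1)%N by apply: leq_ltn_trans (ltn_ord i).
have := @multiplier4_inj m i (Ordinal n0).
rewrite !lt0n => inj; congr (~~ _).
apply/eqP/eqP => [E|->]; last by rewrite muln0 mod0n.
suff -> : i = Ordinal n0 by [].
by apply: inj; apply/val_inj; rewrite /= E muln0 mod0n.
Qed.

(* The defining product of Cgen_poly does lie in F_4[x]. *)
Lemma Cgen_polyE (F : finFieldType) (L : fieldType) (iota : {rmorphism F -> L})
    (e m : nat) (alpha : L) :
  #|F| = 4%N -> alpha ^+ (4 ^ m - 1) = 1 ->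
  map_poly iota (Cgen_poly iota e m alpha) = zeros_poly alpha (Tset e m).
Proof.
move=> cF a1; set G := zeros_poly _ _.
have pF : 2 \in [pchar F] by apply: (@card_finPcharP F 2 2).
  have pL : 2 \in [pchar L] by exact: rmorph_pchar pF.
pose phi : {rmorphism L -> L} := pFrobenius_aut pL \o pFrobenius_aut pL.
have phiE x : phi x = x ^+ 4 by rewrite /= !pFrobenius_autE -exprM.
have phiG : map_poly phi G = G.
  rewrite /G /zeros_poly rmorph_prod [RHS](reindex_inj (@multiplier4_inj m)) /=.
  apply: eq_big => [j|j _]; first by rewrite multiplier4_Tset.
  rewrite rmorphB /= map_polyX map_polyC /= !pFrobenius_autE.
  by rewrite -!exprM (expr_mod (4 * j) a1) mulnC.
have imG k : exists x, iota x = G`_k.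
  have : root (map_poly iota ('X^#|F| - 'X)) G`_k.
    rewrite rmorphB rmorphXn /= map_polyX cF rootE !hornerE subr_eq0 /=.
    by rewrite -phiE -coef_map phiG.
  rewrite finField_genPoly rmorph_prod /=.
  under eq_bigr do rewrite rmorphB /= map_polyX map_polyC /=.
  rewrite /root horner_prod prodf_seq_eq0 => /hasP[x _ /=].
  by rewrite hornerXsubC subr_eq0 => /eqP ->; exists x.
have d0 : descend iota 0 = 0.
  by rewrite /descend; case: pickP => //= x; rewrite fmorph_eq0 => /eqP.
apply/polyP => k; rewrite coef_map /Cgen_poly coef_map_id0 // -/G.
have [x Ex] := imG k; rewrite /descend; case: pickP => [y /eqP//|/(_ x)].
by rewrite Ex eqxx.
Qed.

(* Main.v *)
Require Import Defs.
From mathcomp Require Import all_boot all_order all_algebra.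
From mathcomp Require Import all_fingroup all_solvable all_field.
From mathcomp Require Import zify.

(** Each base-4 digit d of i becomes 3 - d in n - i, so
    w(n - i) = 3m - w(i), which for odd m has parity opposite to w(i). Hence the
    multiplier by -1 exchanges the two defining sets. *)

Local Open Scope ring_scope.

Import GRing.Theory.

(** Parity of the 4-weight splits the nonzero residues into the two defining sets. For odd [m],
    [weight4_compl] makes negation modulo [n] flip that parity, so [b = n - 1] swaps the sets
    ([multiplier_opp_imset]). That these really are defining sets of the two codes is
    [Cgen_defining_set], with [generator_prim_root] making [alpha] a primitive [n]-th root of
    unity. *)

Lemma weight4_compl m i : (i < 4 ^ m)%N ->
  (weight4 m (4 ^ m - 1 - i) + weight4 m i = 3 * m)%N.
Proof.
elim: m i => [|m IHm] i; first by rewrite /weight4 !big_ord0.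
rewrite !weight4_recl expnS => lti.
have lti4 : (i %/ 4 < 4 ^ m)%N by rewrite ltn_divLR //; lia.
(* All digits of [4 * 4 ^ m - 1] are 3, so the subtraction never borrows. *)
have -> : ((4 * 4 ^ m - 1 - i) %% 4 = 3 - i %% 4)%N by lia.
have -> : ((4 * 4 ^ m - 1 - i) %/ 4 = 4 ^ m - 1 - i %/ 4)%N by lia.
have := IHm _ lti4; lia.
Qed.

Lemma multiplier_opp n (i : 'I_n) :
  (0 < i)%N -> multiplier (n - 1) i = (n - i)%N :> nat.
Proof.
move=> i0; have lin := ltn_ord i => /=.
have -> : ((n - 1) * i = (i - 1) * n + (n - i))%N by nia.
by rewrite modnMDl modn_small //; lia.
Qed.

Lemma multiplier_oppK n : involutive (@multiplier n (n - 1)).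
Proof.
move=> i; apply/val_inj; have lin := ltn_ord i.
have [i0|i0] := posnP i; first by rewrite /= i0 !(muln0, mod0n).
have Ei := multiplier_opp n i i0.
rewrite -[val _]/(nat_of_ord _) multiplier_opp Ei /=; lia.
Qed.

Lemma multiplier_opp_Tset m e (i : 'I_(4 ^ m - 1)) : odd m ->
  (multiplier (4 ^ m - 1 - 1) i \in Tset e m) = (i \in Tset e.+1 m).
Proof.
move=> om; have lin := ltn_ord i; rewrite !inE.
(* Zero is fixed by negation and lies in neither set. *)
have [i0|i0] := posnP i; first by rewrite /= i0 muln0 mod0n.
rewrite multiplier_opp //; have := weight4_compl m i.
by have := odd_double_half m; rewrite om; lia.
Qed.

(** Negation is an involution, so image and preimage coincide. *)
Lemma multiplier_opp_imset m e : odd m ->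
  [set multiplier (4 ^ m - 1 - 1) i | i in Tset e.+1 m] = Tset e m.
Proof.
move=> om; apply/setP => j; rewrite -[j in LHS]multiplier_oppK.
rewrite mem_imset; last exact: can_inj (@multiplier_oppK _).
by rewrite -multiplier_opp_Tset // multiplier_oppK.
Qed.

Lemma ideal_gen_cyclic (F : finFieldType) n (g : {poly F}) :
  cyclic_code (ideal_gen n g).
Proof.
split; first by apply/imsetP; exists 0; rewrite ?inE ?mul0r.
move=> a _ _ /imsetP[x _ ->] /imsetP[y _ ->].
by apply/imsetP; exists (a * x + y); rewrite ?inE // mulrDl mulrA.
Qed.

Lemma zeros_poly_monic (L : fieldType) n (beta : L) (T : {set 'I_n}) :
  zeros_poly beta T \is monic.
Proof. exact: monic_prod_XsubC. Qed.

Lemma zeros_poly_dvd (L : fieldType) n (beta : L) (T : {set 'I_n}) :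
  n.-primitive_root beta -> zeros_poly beta T %| 'X^n - 1.
Proof.
move=> pb; rewrite -(factor_Xn_sub_1 pb) big_mkord.
by rewrite (bigID (mem T)) /= dvdp_mulr.
Qed.

(** Monicity and divisibility can be tested after the embedding [iota]; over [L], ['X^n - 1] is the
    product of all ['X - alpha^j], of which the generator takes a subproduct. *)
Lemma Cgen_defining_set (F : finFieldType) (L : fieldType)
    (iota : {rmorphism F -> L}) e m (alpha : L) : #|F| = 4%N -> (4 ^ m - 1).-primitive_root alpha ->
  defining_set iota alpha (Ccode iota e m alpha) (Tset e m).
Proof.
move=> cF pa; have E := Cgen_polyE iota e cF (prim_expr_order pa).
exists (Cgen_poly iota e m alpha) => //; split=> //.
  by rewrite -(map_monic iota) E zeros_poly_monic.
rewrite -(dvdp_map iota) E rmorphB /= map_polyXn rmorph1.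
exact: zeros_poly_dvd.
Qed.

Lemma generator_prim_root (L : finFieldType) (alpha : {unit L}) :
  generator [set: {unit L}] alpha ->
  #|L|.-1.-primitive_root (FinRing.uval alpha).
Proof.
move=> /eqP ga; have o : #[alpha]%g = #|L|.-1.
  by rewrite orderE -ga card_finField_unit.
rewrite -o; apply/andP; split; first exact: order_gt0.
apply/forallP => i; rewrite unity_rootE -FinRing.val_unitX -(FinRing.val_unit1 L).
rewrite (inj_eq val_inj) -order_dvdn; apply/eqP.
apply/idP/eqP => [/dvdn_leq|->//]; have := ltn_ord i; lia.
Qed.

Theorem theorem5p1p2 (m : nat) (F L : finFieldType)
    (iota : {rmorphism F -> L}) (alpha : {unit L}) :
  (1 <= m)%N -> odd m -> #|F| = 4%N -> #|L| = (4 ^ m)%N ->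
  generator [set: {unit L}] alpha ->
  odd_like_duadic_pair iota (FinRing.uval alpha)
    (Ccode iota 0 m (FinRing.uval alpha))
    (Ccode iota 1 m (FinRing.uval alpha)).
Proof.
move=> m0 om cF cL /generator_prim_root; rewrite cL -subn1 => pa.
have n0 : (0 < 4 ^ m - 1)%N by exact: prim_order_gt0 pa.
have q0 : (0 < 4 ^ m)%N by rewrite expn_gt0.
split=> //; try exact: ideal_gen_cyclic.
  rewrite cF (coprimeXr 2 (_ : coprime _ 2)) // coprimen2 oddB //.
  by rewrite oddX /=; lia.
exists (Tset 0 m), (Tset 1 m); split.
- by split; apply: Cgen_defining_set.
- by split=> i; rewrite inE -lt0n => /andP[].
- by split; apply/setP => i; rewrite !inE; lia.
exists (4 ^ m - 1 - 1)%N; split.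
(* Consecutive integers are coprime. *)
- by rewrite -{2}(subnK n0) addn1 coprimenS.
(* Only [e] modulo 2 matters; writing 0 as 2 fits the step from [e.+1] to [e]. *)
- have -> : Tset 0 m = Tset 2 m by apply/setP => i; rewrite !inE.
  exact: multiplier_opp_imset.
- exact: multiplier_opp_imset.
Qed.
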